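(* Let $k$ be a field of characteristic zero and $H=\langle x,y\mid [[y,x],x]=[[y,x],y]=0\rangle$ the Heisenberg Lie $k$-algebra. Let $\mathfrak{D}(H)$ be the Ore division ring of fractions of $U(H)$. Set $z=[y,x]$, $V=\tfrac12 z(xy+yx)z$, and $$S=(V-\tfrac13z^3)(V+\tfrac13z^3)^{-1}+(V-\tfrac13z^3)^{-1}(V+\tfrac13z^3),\qquad T=(z+y^2)^{-1}(z-y^2)\,S\,(z+y^2)(z-y^2)^{-1}.$$ Then (1) the $k$-subalgebra of $\mathfrak{D}(H)$ generated by $S$ and $T$ is the free $k$-algebra on $\{S,T\}$ (in particular all the displayed inverses exist), and (2) $S$ and $T$ are symmetric, i.e. $S^*=S$, $T^*=T$, for the principal involution $*$ on $\mathfrak{D}(H)$.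
   Context: $U(H)$ is an Ore domain. The principal involution of $U(H)$ is the unique $k$-linear anti-automorphism of order two with $a^*=-a$ for $a\in H$; it extends uniquely to an involution of the Ore division ring of fractions $\mathfrak{D}(H)$ (with $(f^{-1})^*=(f^* )^{-1}$). The free $k$-algebra on a set $X$ is the algebra of noncommutative polynomials in $X$. *)

(* Defs.v *)
From HB Require Import structures.
From mathcomp Require Import all_boot all_order all_algebra.
Set Implicit Arguments. Unset Strict Implicit. Unset Printing Implicit Defensive.
Import GRing.Theory.
Local Open Scope ring_scope.

Definition lbr (R : pzRingType) (a b : R) : R := a * b - b * a.

(* Evaluation of a word over the two-letter alphabet {false, true} at
   (a, b): false |-> a, true |-> b.  Words are the monomials of the free
   k-algebra on two generators. *)
Definition weval (R : pzRingType) (a b : R) (w : seq bool) : R :=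
  foldr (fun c r => (if c then b else a) * r) 1 w.

Definition peval (k : pzRingType) (A : lalgType k) (a b : A)
  (p : seq (k * seq bool)) : A :=
  \sum_(q <- p) q.1 *: weval a b q.2.

Definition heis_rel (R : pzRingType) (x y : R) : Prop :=
  lbr (lbr y x) x = 0 /\ lbr (lbr y x) y = 0.

(* The k-subalgebra of A generated by a and b is free on {a, b}: the
   evaluation map from the free algebra k<X,Y> (basis: words) is injective,
   i.e. distinct words evaluate to k-linearly independent elements. *)
Definition free_on2 (k : pzRingType) (A : lalgType k) (a b : A) : Prop :=
  forall p : seq (k * seq bool), uniq (map snd p) ->
    peval a b p = 0 -> all (fun q => q.1 == 0) p.

(* The canonical map U(H) -> D, X |-> x, Y |-> y, is injective: every
   noncommutative polynomial vanishing at (x, y) vanishes at every pair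
   (b1, b2) satisfying the Heisenberg relations in any k-algebra B
   (in particular in U(H) itself at its generators). *)
Definition UH_embeds (k : fieldType) (D : algType k) (x y : D) : Prop :=
  forall p : seq (k * seq bool), peval x y p = 0 ->
    forall (B : algType k) (b1 b2 : B), heis_rel b1 b2 -> peval b1 b2 p = 0.

(* Every element of D is a right fraction a b^-1 of elements of the image
   of U(H) (the subalgebra generated by x and y), with b nonzero. *)
Definition right_fractions (k : fieldType) (D : unitAlgType k) (x y : D) : Prop :=
  forall d : D, exists p q : seq (k * seq bool),
    peval x y q != 0 /\ d = peval x y p * (peval x y q)^-1.

Definition division_ring (D : unitRingType) : Prop :=
  forall d : D, d != 0 -> d \is a GRing.unit.

Definition principal_involution (k : fieldType) (D : unitAlgType k)
  (x y : D) (star : D -> D) : Prop :=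
  [/\ forall (c : k) (u v : D), star (c *: u + v) = c *: star u + star v,
      forall u v : D, star (u * v) = star v * star u,
      star 1 = 1,
      forall u : D, star (star u) = u &
      star x = - x /\ star y = - y].

Section Elements.
Variables (k : fieldType) (D : unitAlgType k) (x y : D).
Definition hz : D := lbr y x.
Definition hV : D := (2%:R : k)^-1 *: (hz * (x * y + y * x) * hz).
Definition hP : D := hV - (3%:R : k)^-1 *: hz ^+ 3.
Definition hQ : D := hV + (3%:R : k)^-1 *: hz ^+ 3.
Definition hS : D := hP * hQ^-1 + hP^-1 * hQ.
Definition hT : D :=
  (hz + y ^+ 2)^-1 * (hz - y ^+ 2) * hS * (hz + y ^+ 2) * (hz - y ^+ 2)^-1.
End Elements.

(* Main.v *)
Require Import Defs.
From HB Require Import structures.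
From mathcomp Require Import all_boot all_order all_algebra ring.
Set Implicit Arguments. Unset Strict Implicit. Unset Printing Implicit Defensive.
Import GRing.Theory.
Local Open Scope ring_scope.

(* Put v = x y / z + 1/2, w = y^2 / z and c = (1 - w) / (1 + w).  Then
   [v, w] = -2 w, S = 2 + (4/9) (v^2 - 1/9)^-1 and T = c S c^-1.  Up to powers
   of c, a word in S and T is an iterated inverse of the "differential operator"
   v^2 - 1/9, with one of 1, c, c^-1 inserted between consecutive letters; as for
   iterated integrals, a linear dependence over k(w) is differentiated, by left
   multiplication with v - 1/3 or v + 1/3, until it exhibits a nonzero
   k-combination of 1, c (or of 1, c^-1) as a derivative [v, h] with h in k(w).
   This is impossible, because the corresponding form (p + q c^(+-1)) dw / w has a
   nonzero residue at 0, 1 or -1.  As 2/3 is not an even integer, it is not an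
   eigenvalue of [v, -] on k(w), which keeps v - 1/3 and v + 1/3 from interfering. *)

(** * Derivatives of rational functions *)

Section Euler.
Variable k : fieldType.
Hypothesis char0 : [pchar k] =i pred0.
Implicit Types p q : {poly k}.

Lemma natrk_eq0 n : (n%:R == 0 :> k) = (n == 0)%N.
Proof. exact: (pcharf0P k).1. Qed.

Lemma eqrk_nat m n : (m%:R == n%:R :> k) = (m == n).
Proof.
wlog le : m n / (m <= n)%N => [W|].
  by have [/W//|/ltnW/W] := leqP m n; rewrite eq_sym => ->; rewrite eq_sym.
by rewrite eq_sym -subr_eq0 -natrB // natrk_eq0 subn_eq0 eqn_leq le.
Qed.

(* [eul] is the derivation of k['X] induced by [v, -] through 'X |-> w. *)
Definition eul p : {poly k} := - 2%:R *: ('X * p^`()).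

Lemma eulX : eul 'X = - 2%:R *: 'X.
Proof. by rewrite /eul derivX mulr1. Qed.

Lemma eulM p q : eul (p * q) = eul p * q + p * eul q.
Proof.
by rewrite /eul derivM -!mul_polyC; ring.
Qed.

Lemma coef_eul p i : (eul p)`_i = - (2 * i)%:R * p`_i.
Proof.
rewrite /eul coefZ coefXM; case: i => [|i] /=.
  by rewrite muln0 mulr0 oppr0 mul0r.
by rewrite coef_deriv natrM !mulNr -mulrA [i.+1%:R * _]mulr_natl.
Qed.

(** Each ['X^i] is an eigenvector of [eul] for -2i, so this multiple of p cancels the leading
    term. *)
Lemma size_eul_lt p : p != 0 ->
  (size (eul p + (2 * (size p).-1)%:R *: p)%R < size p)%N.
Proof.
move=> p0; have sp : (0 < size p)%N by rewrite size_poly_gt0.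
rewrite -(prednK sp) ltnS; apply/leq_sizeP => j.
rewrite leq_eqVlt coefD coefZ coef_eul => /orP[/eqP<-|].
  by rewrite prednK // mulNr addNr.
by rewrite prednK // => /leq_sizeP/(_ _ (leqnn j)) ->; rewrite !mulr0 addr0.
Qed.

(** The equation makes mu an eigenvalue of the derivation at p / q; it is read off in degree deg p +
    deg q, where only leading terms count. *)
Lemma eul_eigen_quotient p q (mu : k) : p != 0 -> q != 0 ->
  eul p * q - p * eul q = mu *: (p * q) ->
  mu = (2 * (size q).-1)%:R - (2 * (size p).-1)%:R.
Proof.
move=> p0 q0 e; apply/eqP; rewrite -subr_eq0.
set a := (2 * (size q).-1)%:R; set b := (2 * (size p).-1)%:R.
set nu := _ - _; apply/negPn/negP => nu0.
have e1 : nu *: (p * q) = (eul p + b *: p) * q - p * (eul q + a *: q).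
  move: e; rewrite /nu -!mul_polyC !polyCB mulrBl => <-; ring.
have sp : (0 < size p)%N by rewrite size_poly_gt0.
have sq : (0 < size q)%N by rewrite size_poly_gt0.
have := size_scale (p * q) nu0; rewrite e1 size_mul // => sE.
have : (size ((eul p + b *: p) * q - p * (eul q + a *: q))%R < (size p + size q).-1)%N.
  apply: leq_ltn_trans (size_polyD _ _) _; rewrite size_polyN gtn_max.
  have h1 := size_polyMleq (eul p + b *: p) q.
  have h2 := size_polyMleq p (eul q + a *: q).
  have h3 := size_eul_lt p0; have h4 := size_eul_lt q0.
  apply/andP; split.
    apply: leq_ltn_trans h1 _.
    by move: h3 sp sq; rewrite -/b; case: (size q) => // m; rewrite !addnS /= ltn_add2r.
  apply: leq_ltn_trans h2 _.
  by move: h4 sp sq; rewrite -/a; case: (size p) => // m; rewrite !addSn /= ltn_add2l.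
by rewrite sE ltnn.
Qed.

(* If t(r) <> 0, then (p / q)' = t / (('X - r) f) has a simple pole at r. *)
Lemma no_residue p q (f t : {poly k}) (r : k) : q != 0 -> ~~ root f r ->
  ('X - r%:P) * (p^`() * q - p * q^`()) * f = q ^+ 2 * t -> root t r.
Proof.
move=> q0 fr; set a := 'X - r%:P.
have aM : a \is monic by exact: monicXsubC.
have a0 : a != 0 by exact: monic_neq0.
have ar : a.[r] = 0 by rewrite /a !hornerE subrr.
(* Induction on the size of q, so that common factors ['X - r%:P] of p and q can be cancelled. *)
elim: {q}(size q) {-2}q p (leqnn (size q)) q0 => [|n IH] q p sq q0 e.
  by move: sq; rewrite leqn0 size_poly_eq0 (negPf q0).
have [qr|qr] := boolP (root q r); last first.
  move/(congr1 (fun u => u.[r])): e; rewrite !hornerM ar !mul0r => /esym/eqP.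
  by rewrite !mulf_eq0 -!rootE (negPf qr).
have [pr|pr] := boolP (root p r).
  have [q1 eq1] := factor_theorem q r qr; have [p1 ep1] := factor_theorem p r pr.
  have q10 : q1 != 0 by apply: contraNneq q0 => q10; rewrite eq1 q10 mul0r.
  apply: (IH q1 p1) => //.
    by move: sq; rewrite eq1 size_Mmonic // size_XsubC addn2.
  have a20 : a ^+ 2 != 0 by rewrite expf_neq0.
  apply: (mulfI a20); move: e; rewrite eq1 ep1 !derivM !derivXsubC -/a => e.
  transitivity (a * ((p1^`() * a + p1 * 1) * (q1 * a) - p1 * a * (q1^`() * a + q1 * 1)) * f).
    ring.
  by rewrite e; ring.
(* Now p(r) is nonzero and q vanishes at r to a positive order. Cancelling powers of [a] and
   evaluating at r leaves that order times p(r) q1(r) f(r) = 0, impossible in characteristic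
   zero. *)
have [m [q1 q1r eq1]] := multiplicity_XsubC q r; rewrite q0 /= -/a in q1r eq1.
case: m eq1 => [|m] eq1.
  by move: qr; rewrite eq1 expr0 mulr1 (negPf q1r).
have am0 : a ^+ m.+1 != 0 by rewrite expf_neq0.
have e1 : (a * (p^`() * q1 - p * q1^`()) - m.+1%:R *: (p * q1)) * f = a ^+ m.+1 * q1 ^+ 2 * t.
  apply: (mulfI am0); move: e; rewrite eq1 derivM deriv_exp derivXsubC -/a /= mul1r.
  rewrite -mulr_natl => e.
  rewrite -mul_polyC polyC_natr.
  transitivity (a * (p^`() * (q1 * a ^+ m.+1) - p *
    (q1^`() * a ^+ m.+1 + q1 * (m.+1%:R * a ^+ m))) * f); last by rewrite e; ring.
  by rewrite exprS; ring.
clearbody a; move/(congr1 (fun u => u.[r])): e1.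
rewrite !(hornerM, hornerD, hornerN, hornerZ, horner_exp) ar expr0n /= !mul0r add0r => /eqP.
rewrite mulf_eq0 -rootE (negPf fr) orbF oppr_eq0 !mulf_eq0 natrk_eq0 /=.
by rewrite -!rootE (negPf pr) (negPf q1r).
Qed.

(** A derivative has no residue at the simple poles 0 and -u, so the last factor vanishes there: a +
    b = 0, and then 2 u a = 0. *)
Lemma eul_quotient_residues p q (a b u : k) : q != 0 -> u ^+ 2 = 1 ->
  (eul p * q - p * eul q) * (1 + u%:P * 'X) =
    q ^+ 2 * (a%:P * (1 - 'X) + b%:P * (1 + 'X)) -> a = 0 /\ b = 0.
Proof.
move=> q0 u2; set t := a%:P * _ + _ => e.
have two0 : 2%:R != 0 :> k by rewrite natrk_eq0.
have u0 : u != 0 by apply: contra_eqN u2 => /eqP->; rewrite expr0n eq_sym oner_eq0.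
have e' : - 2%:R *: ('X * (p^`() * q - p * q^`())) * (1 + u%:P * 'X) = q ^+ 2 * t.
  by rewrite -e /eul -!mul_polyC; ring.
have : root t (- u).
  (* Since u^2 = 1, the factor 1 + uX is u (X + u), which exhibits the pole at -u; the remaining
     factors make up f. *)
  apply: (@no_residue p q (- (2%:R * u)%:P * 'X)) => //.
    by rewrite rootE !hornerE mulf_eq0 !oppr_eq0 mulf_eq0 (negPf two0) (negPf u0).
  rewrite -e' -mul_polyC.
  transitivity ((- (2%:R : k))%:P * ('X * (p^`() * q - p * q^`())) * ((u ^+ 2)%:P + u%:P * 'X)).
    by rewrite !(polyCN, polyCM, polyC_exp); ring.
  by rewrite u2 polyC1.
rewrite rootE /t !hornerE => /eqP tu.
have : root t 0.
  apply: (@no_residue p q (- (2%:R : k)%:P * (1 + u%:P * 'X))) => //.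
    by rewrite rootE !hornerE oppr_eq0.
  by rewrite -e' -mul_polyC polyC0 polyCN; ring.
rewrite rootE /t !hornerE => /eqP t0.
have ba : b = - a by apply/eqP; rewrite -subr_eq0 opprK addrC; apply/eqP; rewrite -t0; ring.
have : 2%:R * u * a = 0 by rewrite -tu ba; ring.
move/eqP; rewrite !mulf_eq0 (negPf two0) (negPf u0) /= => /eqP a0.
by rewrite ba a0 oppr0.
Qed.
End Euler.

(** * The field k(w) in a division ring with [v, w] = - 2 w *)

Section FreePair.
Variables (k : fieldType) (D : unitAlgType k).
Hypothesis char0 : [pchar k] =i pred0.
Hypothesis divD : division_ring D.
Variables v w : D.
Hypothesis w0 : w != 0.
Hypothesis vw : lbr v w = - 2%:R *: w.
Implicit Types (f g h : D) (p q : {poly k}).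

Lemma divD_mulf_eq0 f g : f * g = 0 -> g != 0 -> f = 0.
Proof. by move=> e /divD ug; apply: (mulIr ug); rewrite mul0r. Qed.

Local Notation ev := (horner_alg w).
Local Notation del := (lbr v).

Lemma lbrD f g : del (f + g) = del f + del g.
Proof. by rewrite /lbr mulrDr mulrDl opprD addrACA. Qed.

Lemma lbrZ (a : k) f : del (a *: f) = a *: del f.
Proof. by rewrite /lbr -scalerAr -scalerAl scalerBr. Qed.

Lemma lbrM f g : del (f * g) = del f * g + f * del g.
Proof. by rewrite /lbr mulrBl mulrBr !mulrA subrKA. Qed.

Lemma lbr_alg (a : k) : del a%:A = 0.
Proof. by rewrite /lbr mulr_algl mulr_algr subrr. Qed.

Lemma lbr_sum (I : Type) (r : seq I) (P : pred I) (F : I -> D) :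
  del (\sum_(i <- r | P i) F i) = \sum_(i <- r | P i) del (F i).
Proof.
by rewrite /lbr mulr_sumr mulr_suml -sumrB.
Qed.

Lemma evZ (a : k) p : ev (a *: p) = a *: ev p.
Proof. by rewrite -mul_polyC rmorphM /= horner_algC mulr_algl. Qed.

Lemma lbr_ev p : del (ev p) = ev (eul p).
Proof.
elim/poly_ind: p => [|p c IH].
  by rewrite /eul deriv0 mulr0 scaler0 rmorph0 /lbr mulr0 mul0r subrr.
have -> : eul (p * 'X + c%:P) = eul p * 'X + p * (- 2%:R *: 'X).
  by rewrite -eulX -eulM /eul derivD derivC addr0.
by rewrite !rmorphD !rmorphM /= (evZ _ 'X) horner_algX horner_algC
  lbrD lbr_alg addr0 lbrM IH vw.
Qed.

(** If p of degree d vanishes at w, so does [eul p + (2 * d)%:R *: p], which is smaller and hence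
    zero by induction. Then p is a monomial, and a nonzero monomial takes a nonzero value at w. *)
Lemma ev_inj p : ev p = 0 -> p = 0.
Proof.
elim: {p}(size p) {-2}p (leqnn (size p)) => [|n IH] p sp e.
  by apply/eqP; rewrite -size_poly_eq0 -leqn0.
apply: contra_eq (e) => p0.
set d := (size p).-1.
have q0 : eul p + (2 * d)%:R *: p = 0.
  apply: IH; first by rewrite -ltnS (leq_trans _ sp) // size_eul_lt.
  by rewrite rmorphD /= (evZ _ p) -lbr_ev e /lbr mulr0 mul0r subrr scaler0 addr0.
have pE : p = lead_coef p *: 'X^d.
  apply/polyP => i; rewrite coefZ coefXn.
  have [->|ne] := eqVneq i d; first by rewrite mulr1.
  move/(congr1 (fun u : {poly k} => u`_i)): q0.
  rewrite coefD coefZ coef_eul coef0 -mulrDl => /eqP.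
  rewrite mulr0 mulf_eq0 addrC subr_eq0 => /orP[|/eqP//].
  by rewrite eqrk_nat // eqn_pmul2l // eq_sym (negPf ne).
have uw : w ^+ d \is a GRing.unit by apply/unitrX/divD.
move: e; rewrite pE evZ rmorphXn /= horner_algX -mulr_algl => /(congr1 ( *%R^~ (w ^+ d)^-1)).
rewrite mulrK // mul0r => /eqP.
by rewrite scaler_eq0 lead_coef_eq0 oner_eq0 (negPf p0).
Qed.

Lemma ev_unit q : q != 0 -> ev q \is a GRing.unit.
Proof. by move=> q0; apply: divD; apply: contraNneq q0 => /ev_inj->. Qed.

Lemma evC p q : ev p * ev q = ev q * ev p.
Proof. by rewrite -!rmorphM /= mulrC. Qed.

Definition inK f := exists p q, q != 0 /\ f = ev p / ev q.

Lemma inKP f p q : q != 0 -> f * ev q = ev p -> inK f.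
Proof. by move=> q0 e; exists p, q; rewrite -e mulrK // ev_unit. Qed.

Lemma inK_ev p : inK (ev p).
Proof. by apply: (@inKP _ p 1); rewrite ?oner_neq0 // rmorph1 mulr1. Qed.

Lemma inK_alg a : inK a%:A.
Proof. by rewrite -(horner_algC w); apply: inK_ev. Qed.

Lemma inK0 : inK 0.
Proof. by rewrite -(scale0r (1 : D)); apply: inK_alg. Qed.

Lemma inK1 : inK 1.
Proof. by rewrite -(scale1r (1 : D)); apply: inK_alg. Qed.

Lemma inK_w : inK w.
Proof. by have := inK_ev 'X; rewrite horner_algX. Qed.

Lemma inK_comm_ev f p : inK f -> f * ev p = ev p * f.
Proof.
case=> p1 [q1 [q10 ->]]; apply/esym/commrM; first exact: evC.
exact/commrV/evC.
Qed.

Lemma inK_comm f g : inK f -> inK g -> f * g = g * f.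
Proof.
move=> Kf [p [q [q0 ->]]]; apply: commrM; first exact: inK_comm_ev.
exact/commrV/inK_comm_ev.
Qed.

Lemma inKD f g : inK f -> inK g -> inK (f + g).
Proof.
move=> [p [q [q0 ->]]] [p' [q' [q'0 ->]]].
apply: (@inKP _ (p * q' + p' * q) (q * q')); first by rewrite mulf_neq0.
rewrite mulrDl {2}[q * q']mulrC !rmorphM /= !mulrA !divrK ?ev_unit //.
by rewrite !rmorphD !rmorphM.
Qed.

Lemma inKM f g : inK f -> inK g -> inK (f * g).
Proof.
move=> Kf [p' [q' [q'0 ->]]]; case: (Kf) => p [q [q0 fE]].
apply: (@inKP _ (p * p') (q * q')); first by rewrite mulf_neq0.
rewrite [q * q']mulrC !rmorphM /= -!mulrA mulKr ?ev_unit // [ev p' * ev q]evC mulrA fE.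
by rewrite divrK ?ev_unit.
Qed.

Lemma inKZ (a : k) f : inK f -> inK (a *: f).
Proof. by rewrite -mulr_algl; apply/inKM/inK_alg. Qed.

Lemma inKV f : inK f -> inK f^-1.
Proof.
case=> p [q [q0 ->]]; have [->|p0] := eqVneq p 0.
  by rewrite rmorph0 mul0r invr0; apply: inK0.
apply: (@inKP _ q p) => //.
by rewrite invrM ?unitrV ?ev_unit // invrK divrK ?ev_unit.
Qed.

Lemma inK_sum (I : Type) (r : seq I) (P : pred I) (F : I -> D) :
  (forall i, inK (F i)) -> inK (\sum_(i <- r | P i) F i).
Proof. by move=> KF; apply: big_ind => //; [apply: inK0 | apply: inKD]. Qed.

Lemma lbr_frac p q : q != 0 ->
  del (ev p / ev q) * ev (q ^+ 2) = ev (eul p * q - p * eul q).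
Proof.
move=> q0; have uq := ev_unit q0; set f := ev p / ev q.
have Kf : inK f by exists p, q.
have fq : f * ev q = ev p by rewrite divrK.
have := lbrM f (ev q); rewrite fq !lbr_ev => e.
rewrite rmorphXn expr2 mulrA -[del f * ev q](addrK (f * ev (eul q))) -e.
rewrite mulrBl rmorphB !rmorphM /=; congr (_ - _).
by rewrite -mulrA evC mulrA fq.
Qed.

Lemma inK_lbr f : inK f -> inK (del f).
Proof.
case=> p [q [q0 ->]]; apply: (inKP _ (lbr_frac p q0)).
by rewrite expf_neq0.
Qed.

Lemma frac_eigenvalue p q (mu : k) : p != 0 -> q != 0 ->
  del (ev p / ev q) = mu *: (ev p / ev q) ->
  mu = (2 * (size q).-1)%:R - (2 * (size p).-1)%:R.
Proof.
move=> p0 q0 e; have := lbr_frac p q0.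
rewrite e rmorphXn expr2 -scalerAl mulrA divrK ?ev_unit //.
rewrite -rmorphM /= -evZ => /eqP; rewrite -subr_eq0 -rmorphB => /eqP/ev_inj/eqP.
by rewrite subr_eq0 => /eqP/esym/(eul_eigen_quotient p0 q0).
Qed.

Lemma inK_eigen0 f (mu : k) : (forall i j : nat, mu != (2 * i)%:R - (2 * j)%:R) ->
  inK f -> del f = mu *: f -> f = 0.
Proof.
move=> mu0 [p [q [q0 ->]]] e; have [->|p0] := eqVneq p 0.
  by rewrite rmorph0 mul0r.
by have /eqP := frac_eigenvalue p0 q0 e; rewrite (negPf (mu0 _ _)).
Qed.

(** A nonzero constant with denominator q has a numerator of the same degree as q. Subtracting the
    ratio of leading coefficients lowers that degree, so the difference is zero. *)
Lemma inK_const f : inK f -> del f = 0 -> exists a : k, f = a%:A.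
Proof.
case=> p [q [q0 fE]] f0; have [p0|p0] := eqVneq p 0.
  by exists 0; rewrite fE p0 rmorph0 mul0r scale0r.
have eig0 p1 : p1 != 0 -> del (ev p1 / ev q) = 0 -> (size p1).-1 = (size q).-1.
  move=> p10 e; have := @frac_eigenvalue p1 q 0 p10 q0; rewrite e scale0r.
  move=> /(_ erefl)/esym/eqP; rewrite subr_eq0 eqrk_nat // eqn_pmul2l //.
  by move/eqP.
set a := lead_coef p / lead_coef q; exists a.
apply/eqP; rewrite -subr_eq0; apply/negPn/negP => g0.
have gE : f - a%:A = ev (p - a *: q) / ev q.
  by rewrite rmorphB /= evZ mulrBl -fE -scalerAl divrr ?ev_unit.
have p10 : p - a *: q != 0 by apply: contraNneq g0 => e; rewrite gE e rmorph0 mul0r.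
have g'0 : del (f - a%:A) = 0 by rewrite lbrD -scaleNr lbr_alg f0 addr0.
rewrite gE in g'0; rewrite fE in f0.
have sp1 := eig0 _ p10 g'0; have sp := eig0 _ p0 f0.
case/negP: p10; rewrite -lead_coef_eq0 lead_coefE sp1 coefB coefZ -{1}sp -!lead_coefE.
by rewrite divfK ?subrr // lead_coef_eq0.
Qed.

(** * The Cayley transform of w and its residues *)

Definition cay : D := (1 - w) / (1 + w).
(** The conjugator attached to a letter: [false] stands for S, and [true] for T, the conjugate of S
    by [cay]. *)
Definition cpow (b : bool) : D := if b then cay else 1.

Lemma cayE : cay = ev (1 - 'X) / ev (1 + 'X).
Proof. by rewrite rmorphB rmorphD /= horner_algX rmorph1. Qed.

Lemma oneBX_neq0 : (1 - 'X : {poly k}) != 0.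
Proof.
by rewrite -polyC1 -oppr_eq0 opprB polyXsubC_eq0.
Qed.

Lemma oneDX_neq0 : (1 + 'X : {poly k}) != 0.
Proof.
by rewrite addrC -polyC1 -[1%:P]opprK -polyCN polyXsubC_eq0.
Qed.

Lemma oneDw_unit : 1 + w \is a GRing.unit.
Proof. by have := ev_unit oneDX_neq0; rewrite rmorphD /= horner_algX rmorph1. Qed.

Lemma oneBw_unit : 1 - w \is a GRing.unit.
Proof. by have := ev_unit oneBX_neq0; rewrite rmorphB /= horner_algX rmorph1. Qed.

Lemma inK_cpow b : inK (cpow b).
Proof.
case: b; last exact: inK1.
by rewrite /= cayE; exists (1 - 'X), (1 + 'X); rewrite oneDX_neq0.
Qed.

Lemma cpow_unit b : cpow b \is a GRing.unit.
Proof.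
case: b; last exact: unitr1.
by rewrite /= cayE rpred_div ?ev_unit ?oneBX_neq0 ?oneDX_neq0.
Qed.

Lemma cpow_no_log (e : bool) (al : bool -> k) h : inK h ->
  del h = \sum_(b : bool) al b *: ((cpow b)^-1 * cpow e) -> forall b, al b = 0.
Proof.
case=> p [q [q0 ->]]; rewrite big_bool => eqh.
(* The sign is chosen so that 1 + u w is the denominator of c when e holds, and of its inverse
   otherwise. *)
pose u : k := if e then 1 else - 1.
have u2 : u ^+ 2 = 1 by rewrite /u; case: e {eqh u}; rewrite ?expr1n ?sqrrN ?expr1n.
have := lbr_frac p q0; rewrite eqh => eqE.
have [|a0 b0] := @eul_quotient_residues _ char0 p q (al false) (al true) u q0 u2.
  have ub b : (cpow b)^-1 * cpow e * ev (1 + u%:P * 'X) = ev (if b then 1 + 'X else 1 - 'X).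
    have um : ev (1 - 'X) \is a GRing.unit by rewrite ev_unit ?oneBX_neq0.
    have ud : ev (1 + 'X) \is a GRing.unit by rewrite ev_unit ?oneDX_neq0.
    rewrite /u /cpow cayE; case: e {eqh eqE u u2}; case: b.
    - by rewrite polyC1 mul1r mulVr ?mul1r // rpred_div.
    - by rewrite polyC1 mul1r invr1 mul1r divrK.
    - by rewrite polyCN polyC1 mulN1r mulr1 invrM ?unitrV // invrK divrK.
    - by rewrite polyCN polyC1 mulN1r invr1 !mul1r.
  apply/eqP; rewrite -subr_eq0; apply/eqP/ev_inj/eqP; rewrite rmorphB subr_eq0 /=; apply/eqP.
  rewrite rmorphM /= -eqE -mulrA evC mulrA mulrDl -!scalerAl !ub -!evZ.
  by rewrite -rmorphD -rmorphM /= mulrC -!mul_polyC [X in _ * X]addrC.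
by case.
Qed.

(* [inO] is a left k(w)-module stable under v, containing k(w)[v] but no
   nonzero multiple c *: (v - a)^-1. *)
Definition wdiff f := w^-1 * f * w - f.
Definition inO f := exists n, iter n wdiff f = 0.

Let uw : w \is a GRing.unit. Proof. exact: divD. Qed.

Lemma iter_wdiff0 n : iter n wdiff 0 = 0.
Proof. by elim: n => //= n ->; rewrite /wdiff mulr0 mul0r subrr. Qed.

Lemma iter_wdiffD n f g : iter n wdiff (f + g) = iter n wdiff f + iter n wdiff g.
Proof.
elim: n => //= n ->; rewrite /wdiff mulrDr mulrDl opprD.
by rewrite addrACA.
Qed.

Lemma iter_wdiffM n g f : inK g -> iter n wdiff (g * f) = g * iter n wdiff f.
Proof.
move=> Kg; elim: n => //= n ->; rewrite /wdiff mulrBr !mulrA.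
rewrite -[g * w^-1](inK_comm _ Kg) //.
exact/inKV/inK_w.
Qed.

Lemma iter_wdiffZ n (a : k) f : iter n wdiff (a *: f) = a *: iter n wdiff f.
Proof.
by rewrite -[a *: f]mulr_algl -[RHS]mulr_algl iter_wdiffM //; apply: inK_alg.
Qed.

Lemma inO_le n m f : (n <= m)%N -> iter n wdiff f = 0 -> iter m wdiff f = 0.
Proof. by move=> le e; rewrite -(subnK le) iterD e iter_wdiff0. Qed.

Lemma inOD f g : inO f -> inO g -> inO (f + g).
Proof.
move=> [n fn] [m gm]; exists (n + m)%N.
by rewrite iter_wdiffD (inO_le _ fn) ?(inO_le _ gm) ?leq_addr ?leq_addl ?addr0.
Qed.

Lemma inOK g f : inK g -> inO f -> inO (g * f).
Proof. by move=> Kg [n fn]; exists n; rewrite iter_wdiffM // fn mulr0. Qed.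

Lemma inO1 : inO 1.
Proof. by exists 1%N; rewrite /= /wdiff mulr1 mulVr // subrr. Qed.

Lemma conj_v : w^-1 * v * w = v - 2%:R%:A.
Proof.
apply: (mulrI uw); rewrite !mulrA divrr // mul1r mulrBr mulr_algr.
by rewrite -[v * w](subrK (w * v)) -/(lbr v w) vw addrC scaleNr.
Qed.

Lemma wdiff_vM f :
  wdiff (v * f) = v * wdiff f + (- 2%:R) *: wdiff f + (- 2%:R) *: f.
Proof.
rewrite -addrA -scalerDr /wdiff subrK.
have -> : w^-1 * (v * f) * w = w^-1 * v * w * (w^-1 * f * w).
  by rewrite !mulrA mulrK.
by rewrite conj_v mulrBl mulrBr mulr_algl scaleNr addrAC.
Qed.

(** By [wdiff_vM], [wdiff] acts on v as a twisted derivation, so one application more than for f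
    suffices. *)
Lemma inO_v f : inO f -> inO (v * f).
Proof.
case=> n fn; exists n.+1; elim: n f fn => [|n IH] f fn.
  by have -> : f = 0 := fn; rewrite mulr0 iter_wdiff0.
rewrite iterSr wdiff_vM !iter_wdiffD !iter_wdiffZ.
rewrite IH -?iterSr // [iter n.+2 _ f]/= -/(iter n.+1 wdiff f) fn.
by rewrite [wdiff 0](iter_wdiff0 1) !scaler0 !addr0.
Qed.

(** Otherwise v would be a scalar and commute with w, whereas [v, w] = -2 w is nonzero. *)
Lemma v_alg_unit (a : k) : v - a%:A \is a GRing.unit.
Proof.
apply/divD/eqP => e; have := vw; rewrite -[v](subrK a%:A) e add0r.
rewrite /lbr mulr_algl mulr_algr subrr => /esym/eqP; rewrite -mulr_algl => /eqP e2.
have := divD_mulf_eq0 e2 w0 => /eqP.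
by rewrite scaler_eq0 oner_eq0 oppr_eq0 natrk_eq0.
Qed.

(* Up to a nonzero scalar, [pole a n] is the n-th iterate of [wdiff] at (v - a)^-1. *)
Fixpoint pole (a : k) n : D := if n is n'.+1 then
  pole a n' * (v - (a + 2%:R * n%:R)%:A)^-1 else (v - a%:A)^-1.

Lemma pole_unit a n : pole a n \is a GRing.unit.
Proof.
by elim: n => [|n IH]; rewrite /= ?unitrMr ?unitrV ?v_alg_unit.
Qed.

Lemma comm_v_pole a b n : (v - b%:A) * pole a n = pole a n * (v - b%:A).
Proof.
have cc c : GRing.comm (v - b%:A) (v - c%:A).
  apply: commrB; last by rewrite /GRing.comm mulr_algl mulr_algr.
  by apply/commr_sym/commrB => //; rewrite /GRing.comm mulr_algl mulr_algr.
by elim: n => [|n IH] /=; [apply: commrV | apply: commrM => //; apply: commrV].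
Qed.

(** Conjugation by w replaces each factor (v - c)^-1 by (v - c - 2)^-1. Over the common denominator
    [pole a n.+1] the numerators are v - a and v - a - 2(n + 1). *)
Lemma wdiff_pole a n : wdiff (pole a n) = (2%:R * n.+1%:R) *: pole a n.+1.
Proof.
have conj_vc c : w^-1 * (v - c%:A) * w = v - (c + 2%:R)%:A.
  rewrite mulrBr mulrBl conj_v mulr_algr -scalerAl mulVr //.
  by rewrite scalerDl opprD addrA addrAC.
have conjV c : w^-1 * (v - c%:A)^-1 * w = (v - (c + 2%:R)%:A)^-1.
  apply: (mulrI (v_alg_unit (c + 2%:R))); rewrite divrr ?v_alg_unit //.
  by rewrite -conj_vc !mulrA !mulrK ?v_alg_unit // mulVr.
have conjP : w^-1 * pole a n * w = (v - a%:A) * pole a n.+1.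
  elim: n => [|n IH].
    by rewrite conjV /= mulr1 mulrA divrr ?v_alg_unit // mul1r.
  have conjM f g : w^-1 * (f * g) * w = w^-1 * f * w * (w^-1 * g * w).
    by rewrite !mulrA mulrK.
  rewrite [pole a n.+1]/= conjM IH conjV -mulrA; congr (_ * (_ * _^-1)).
  by rewrite -addrA -[in LHS](mulr1 2%:R) -mulrA mul1r -mulrDr natr1.
rewrite /wdiff conjP -[X in _ - X](mulrK (v_alg_unit (a + 2%:R * n.+1%:R))).
rewrite -comm_v_pole -mulrA -/(pole a n.+1) -mulrBl scalerDl opprD addrA.
by rewrite opprK [v - _ - v]addrAC subrr add0r addKr mulr_algl.
Qed.

(** In characteristic zero every iterate of [wdiff] is a nonzero multiple of some [pole a n], which
    is a unit. *)
Lemma pole_notin_O (a c : k) : c != 0 -> ~ inO (c *: pole a 0).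
Proof.
move=> c0 [n]; rewrite iter_wdiffZ.
have : exists2 d : k, d != 0 & iter n wdiff (pole a 0) = d *: pole a n.
  elim: n => [|n [d d0 e]]; first by exists 1; rewrite ?oner_neq0 ?scale1r.
  exists (d * (2%:R * n.+1%:R)).
    by rewrite !mulf_neq0 // natrk_eq0.
  by rewrite iterS e -scalerA -wdiff_pole; have := iter_wdiffZ 1 d (pole a n).
case=> d d0 ->; rewrite scalerA -mulr_algl => e.
have := mulIr (pole_unit a n); move/(_ _ _ (etrans e (esym (mul0r _))))/eqP.
by rewrite scaler_eq0 oner_eq0 mulf_eq0 (negPf c0) (negPf d0).
Qed.

(** * Words in S and T *)

Variables s a b : k.
Hypothesis s_nonint : forall i j : nat, s != i%:R - j%:R.
Hypothesis b0 : b != 0.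

Definition sg (t : bool) : k := if t then s else - s.
Definition quad : D := v ^+ 2 - (s ^+ 2)%:A.
Definition symS : D := a%:A + b *: quad^-1.
Definition symT : D := cay * symS / cay.

Lemma quadE t : quad = (v - (sg t)%:A) * (v + (sg t)%:A).
Proof.
rewrite /quad mulrBl !mulrDr mulr_algr !mulr_algl opprD addrA addrK scalerA.
by rewrite -!expr2; case: t; rewrite /= ?sqrrN.
Qed.

Lemma quad_unit : quad \is a GRing.unit.
Proof.
rewrite (quadE true) unitrMl ?v_alg_unit //.
by rewrite -[_%:A]opprK -scaleNr v_alg_unit.
Qed.

Lemma quadM f : quad * f = v * (v * f) + (- s ^+ 2) *: f.
Proof. by rewrite /quad mulrBl mulr_algl expr2 mulrA scaleNr. Qed.

(* [wvec W] is c^-e * weval symS symT W * c * quad^-1, where e = 1 if W is empty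
   or starts with symT and e = 0 otherwise; see [weval_wvec]. *)
Definition gap (x : bool) (W : seq bool) : D := (cpow x)^-1 * cpow (head true W).
Fixpoint wvec (W : seq bool) : D :=
  if W is x :: W' then symS * (gap x W' * wvec W') else quad^-1.

Lemma weval_wvec W : weval symS symT W * (cay / quad) = cpow (head true W) * wvec W.
Proof.
elim: W => [|x W IH]; first by rewrite /= mul1r.
have -> : weval symS symT (x :: W) = (if x then symT else symS) * weval symS symT W by [].
rewrite -mulrA IH /= /gap.
by case: x; rewrite /= ?invr1 ?mul1r // /symT !mulrA.
Qed.

(** An eigenvector of v for the eigenvalue [sg t] modulo shorter words: by [evec_eigen] the defect
    is [quad * wvec W], which [span_quad_wvec] places at level [size W]. *)
Definition evec (t : bool) (W : seq bool) : D := (v + (sg t)%:A) * wvec W.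

Lemma evec_eigen t W : (v - (sg t)%:A) * evec t W = quad * wvec W.
Proof. by rewrite /evec mulrA -quadE. Qed.

Lemma s0 : s != 0.
Proof. by have := s_nonint 0 0; rewrite subrr. Qed.

Lemma sg0 t : sg t != 0.
Proof. by case: t; rewrite /= ?oppr_eq0 s0. Qed.

Lemma two0 : 2%:R != 0 :> k.
Proof. by rewrite natrk_eq0. Qed.

Lemma wvec_evec W : wvec W = \sum_t (2%:R * sg t)^-1 *: evec t W.
Proof.
rewrite big_bool /= mulrN invrN scaleNr -scalerBr /evec /= -mulrBl scaleNr.
rewrite opprD opprK addrACA subrr add0r -scalerDl mulr_algl -mulr2n -[s *+ 2]mulr_natl scalerA.
by rewrite mulVf ?scale1r ?mul1r // mulf_neq0 ?two0 ?s0.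
Qed.

Lemma sum_evec W : \sum_t evec t W = 2%:R *: (v * wvec W).
Proof.
by rewrite big_bool /evec /= -mulrDl scaleNr addrACA subrr addr0 -mulr2n -scaler_nat scalerAl.
Qed.

(** * The filtration by word length and its stability under v *)

Inductive span (n : nat) : D -> Prop :=
| SpanO f of inO f : span n f
| SpanEvec g t W f of inK g & (size W < n)%N & span n f : span n (g * evec t W + f).

Lemma span0 n : span n 0.
Proof. by apply: SpanO; exists 0%N. Qed.

Lemma spanD n f g : span n f -> span n g -> span n (f + g).
Proof.
move=> Sf Sg; elim: Sf => {f} [f Of|h t W f Kh sW _ IH]; last first.
  by rewrite -addrA; apply: SpanEvec.
elim: Sg => {g} [g Og|h t W g Kh sW _ IH]; first exact/SpanO/inOD.
by rewrite addrCA; apply: SpanEvec.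
Qed.

Lemma spanK n g f : inK g -> span n f -> span n (g * f).
Proof.
move=> Kg; elim=> {f} [f Of|h t W f Kh sW _ IH]; first exact/SpanO/inOK.
by rewrite mulrDr mulrA; apply: SpanEvec => //; apply: inKM.
Qed.

Lemma spanZ n (c : k) f : span n f -> span n (c *: f).
Proof. by rewrite -mulr_algl; apply/spanK/inK_alg. Qed.

Lemma spanB n f g : span n f -> span n g -> span n (f - g).
Proof. by move=> Sf /(spanZ (-1)); rewrite scaleN1r; apply: spanD. Qed.

Lemma span_sum n (I : Type) (r : seq I) (P : pred I) (F : I -> D) :
  (forall i, P i -> span n (F i)) -> span n (\sum_(i <- r | P i) F i).
Proof. by move=> SF; apply: big_ind => //; [apply: span0 | apply: spanD]. Qed.

Lemma span_evec n t W : (size W < n)%N -> span n (evec t W).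
Proof.
by move=> sW; have := SpanEvec t inK1 sW (span0 n); rewrite mul1r addr0.
Qed.

Lemma span_le n m f : (n <= m)%N -> span n f -> span m f.
Proof.
move=> le; elim=> {f} [f Of|h t W f Kh sW _ IH]; first exact: SpanO.
by apply: SpanEvec => //; apply: leq_trans le.
Qed.

Lemma span_wvec n W : (size W < n)%N -> span n (wvec W).
Proof. by move=> sW; rewrite wvec_evec; apply: span_sum => t _; apply/spanZ/span_evec. Qed.

Lemma inK_gap x W : inK (gap x W).
Proof. by apply: inKM; [apply: inKV|]; apply: inK_cpow. Qed.

Lemma quad_wvec x W : quad * wvec (x :: W) =
  a *: (quad * (gap x W * wvec W)) + b *: (gap x W * wvec W).
Proof.
rewrite /= /symS mulrA mulrDr mulr_algr -scalerAr divrr ?quad_unit //.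
by rewrite mulrDl -!scalerAl mul1r.
Qed.

(** Moving v past a coefficient h costs [del h], and on [evec t W] it acts by [sg t] up to
    [quad * wvec W]. The latter applies v twice to a multiple of the [wvec] of the tail of W, which
    lies at a lower level, whence the strong induction. *)
Lemma span_v n f : span n f -> span n (v * f).
Proof.
elim/ltn_ind: n f => n IH f.
have Squad W : (size W < n)%N -> span n (quad * wvec W).
  case: W => [|x W] /= sW; first by rewrite divrr ?quad_unit //; apply/SpanO/inO1.
  rewrite quad_wvec; have SX : span (size W).+1 (gap x W * wvec W).
    exact/spanK/span_wvec/leqnn/inK_gap.
  apply/(span_le (ltnW sW))/spanD; last exact: spanZ.
  by rewrite quadM; apply/spanZ/spanD; [do 2!apply: (IH _ sW)|apply: spanZ].
elim=> {f} [f Of|h t W f Kh sW _ IHf]; first exact/SpanO/inO_v.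
have -> : v * (h * evec t W + f) =
    del h * evec t W + h * (sg t *: evec t W + quad * wvec W) + v * f.
  rewrite mulrDr; congr (_ + _); rewrite -(evec_eigen t).
  rewrite [(v - _%:A) * _]mulrBl mulr_algl [_ + (_ - _)]addrC subrK.
  by rewrite /lbr mulrBl !mulrA subrK.
apply: spanD => //; apply: spanD.
  by apply: spanK; [apply: inK_lbr | apply: span_evec].
by apply: spanK => //; apply: spanD; [apply/spanZ/span_evec | apply: Squad].
Qed.

Lemma span_quad_wvec W : span (size W) (quad * wvec W).
Proof.
case: W => [|x W]; first by rewrite divrr ?quad_unit //; apply/SpanO/inO1.
rewrite quad_wvec; have SX : span (size W).+1 (gap x W * wvec W).
  exact/spanK/span_wvec/leqnn/inK_gap.
apply: spanD; last exact: spanZ.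
by rewrite quadM; apply/spanZ/spanD; [do 2!apply: span_v|apply: spanZ].
Qed.

Lemma span_v_sg n t f : span n f -> span n ((v - (sg t)%:A) * f).
Proof.
by move=> Sf; rewrite mulrBl mulr_algl; apply: spanB; [apply: span_v | apply: spanZ].
Qed.

(** * Independence of the eigenvectors modulo shorter words *)

Lemma span_top n f : span n.+1 f -> exists2 h : bool * n.-tuple bool -> D,
  (forall i, inK (h i)) & span n (f - \sum_i h i * evec i.1 i.2).
Proof.
elim=> {f} [f Of|g t W f Kg sW _ [h Kh Sh]].
  exists (fun=> 0) => [i|]; first exact: inK0.
  by rewrite big1 ?subr0 => [|i _]; [apply: SpanO | rewrite mul0r].
move: sW; rewrite ltnS leq_eqVlt => /orP[sW|sW]; last first.
  by exists h => //; rewrite -addrA; apply: SpanEvec.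
exists (fun i => h i + (if i == (t, Tuple sW) then g else 0)) => [i|].
  by apply: inKD => //; case: ifP => // _; apply: inK0.
under eq_bigr do rewrite mulrDl.
rewrite big_split /= [X in _ - (_ + X)](bigD1 (t, Tuple sW)) //= eqxx.
rewrite [X in _ - (_ + (_ + X))]big1 => [|i /negPf->]; last by rewrite mul0r.
by rewrite addr0 opprD [- _ - _]addrC addrA [g * _ + f]addrC addrK.
Qed.

(** Modulo [span n] the operator v - [sg t] acts on coefficients alone: Leibniz gives the
    derivative, and the eigenvalue of each A i gives the scalar. *)
Lemma v_sum_span n t (I : finType) (A : I -> D) (tag : I -> bool) (g : I -> D) :
  (forall i, inK (g i)) ->
  (forall i, span n ((v - (sg (tag i))%:A) * A i)) ->
  span n ((v - (sg t)%:A) * (\sum_i g i * A i)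
          - \sum_i (del (g i) + (sg (tag i) - sg t) *: g i) * A i).
Proof.
move=> Kg SA; rewrite mulr_sumr -sumrB; apply: span_sum => i _.
suff -> : (v - (sg t)%:A) * (g i * A i) - (del (g i) + (sg (tag i) - sg t) *: g i) * A i
          = g i * ((v - (sg (tag i))%:A) * A i) by apply: spanK.
rewrite [in LHS]mulrA -mulrBl [RHS]mulrA; congr (_ * A i).
rewrite mulrBl mulr_algl scalerBl mulrBr mulr_algr /lbr.
by rewrite opprD !opprB addrACA [v * g i + _]addrC subrK addKr.
Qed.

(* Apply v - l to a relation with the fewest terms, normalised to have some
   coefficient 1 at an eigenvector for l: that term disappears, so all the
   derived coefficients vanish, and the coefficients solve
   [v, g] = (l - l') g in k(w). *)
Lemma eig_indep n (I : finType) (A : I -> D) (tag : I -> bool) :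
  (forall i, span n ((v - (sg (tag i))%:A) * A i)) ->
  (forall t (al : I -> k), (forall i, tag i != t -> al i = 0) ->
     span n (\sum_i al i *: A i) -> forall i, al i = 0) ->
  forall g : I -> D, (forall i, inK (g i)) -> span n (\sum_i g i * A i) -> forall i, g i = 0.
Proof.
move=> SA indep g.
elim: {g}_.+1 {-2}g (ltnSn #|[pred i | g i != 0]|) => // m IH g card Kg Sg i0.
apply/eqP/negPn/negP => gi0; pose t := tag i0.
pose g1 i := (g i0)^-1 * g i.
have Kg1 i : inK (g1 i) by apply: inKM => //; apply: inKV.
have S1 : span n (\sum_i g1 i * A i).
  under eq_bigr do rewrite /g1 -mulrA.
  by rewrite -mulr_sumr; apply: spanK => //; apply: inKV.
have g10 : g1 i0 = 1 by rewrite /g1 mulVr //; apply: divD.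
pose g2 i := del (g1 i) + (sg (tag i) - sg t) *: g1 i.
have g20 i : g2 i = 0.
  apply: IH i => [|i|].
  - rewrite ltnS in card; apply: leq_trans card; apply/proper_card/properP; split; last first.
      by exists i0; rewrite !inE //= /g2 g10 subrr scale0r addr0 /lbr mulr1 mul1r subrr eqxx.
    apply/subsetP => i; rewrite !inE; apply: contraNneq => gi.
    by rewrite /g2 /g1 gi mulr0 scaler0 addr0 /lbr mulr0 mul0r subrr.
  - by apply: inKD; [apply: inK_lbr | apply: inKZ].
  - have := spanB (span_v_sg t S1) (v_sum_span t Kg1 SA).
    by rewrite opprB addrC subrK.
have /fin_all_exists[al alE] : forall i, exists c : k,
    g1 i = c%:A /\ (tag i != t -> c = 0).
  move=> i; have := g20 i; rewrite /g2; have [-> e|ne e] := eqVneq (tag i) t.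
    rewrite subrr scale0r addr0 in e.
    by have [c ->] := inK_const (Kg1 i) e; exists c.
  exists 0; rewrite scale0r; split=> //.
  apply: (@inK_eigen0 (g1 i) (sg t - sg (tag i))) => //; last first.
    by apply/eqP; rewrite -subr_eq0 -scaleNr opprB e.
  (* For distinct tags the eigenvalue is 2s or -2s, which [s_nonint] keeps from being a difference
     of even integers. *)
  move=> j l; move: ne; rewrite !natrM -mulrBr /sg.
  have sn j' l' : 2%:R * s != 2%:R * (j'%:R - l'%:R).
    by rewrite (inj_eq (mulfI two0)).
  case: (tag i); case: (t) => // _.
    rewrite -opprD -mulr2n -[s *+ 2]mulr_natl eqr_oppLR -mulrN opprB; exact: sn.
  by rewrite opprK -mulr2n -[s *+ 2]mulr_natl; exact: sn.
have : al i0 = 0.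
  apply: (indep t al) => [i|]; first by have [] := alE i.
  by under eq_bigr do rewrite -mulr_algl -(alE _).1.
by move/eqP; have [/eqP] := alE i0; rewrite g10 => /eqP e _ /eqP al0;
  move: e; rewrite al0 scale0r => /eqP; rewrite oner_eq0.
Qed.

(* The terms with factor [a] add up to a derivative [v, -], so only
   (b / 2 sg t) *: gap x W matters in [level_indep]. *)
Definition coef (t x : bool) (W : seq bool) : D :=
  a *: del (gap x W) + (2%:R * sg t)^-1 *: (a *: del (del (gap x W)) + b *: gap x W).

Lemma inK_coef t x W : inK (coef t x W).
Proof.
have Kg := inK_gap x W.
apply: inKD; first exact/inKZ/inK_lbr.
apply/inKZ/inKD; last exact: inKZ.
exact/inKZ/inK_lbr/inK_lbr.
Qed.

(** With d = [gap x W], Leibniz twice gives v^2 d f = d v^2 f + 2 d' v f + d'' f. The term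
    [d * (quad * wvec W)] is in [span (size W)], and both [wvec W] and [v * wvec W] are combinations
    of the two [evec t W]. *)
Lemma quad_wvec_mod x W : span (size W) (quad * wvec (x :: W) - \sum_t coef t x W * evec t W).
Proof.
have -> : \sum_t coef t x W * evec t W =
    a *: (2%:R *: (del (gap x W) * (v * wvec W)) + del (del (gap x W)) * wvec W)
    + b *: (gap x W * wvec W).
  under eq_bigr do rewrite /coef mulrDl -[(_^-1 *: _) * _]scalerAl scalerAr.
  rewrite big_split /= -!mulr_sumr -wvec_evec sum_evec mulrDl -!scalerAl addrA -scalerDr.
  by rewrite -scalerAr.
rewrite quad_wvec opprD addrACA subrr addr0 -scalerBr; apply: spanZ.
suff -> : quad * (gap x W * wvec W) = gap x W * (quad * wvec W) +
    (2%:R *: (del (gap x W) * (v * wvec W)) + del (del (gap x W)) * wvec W).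
  by rewrite addrK; apply/spanK/span_quad_wvec/inK_gap.
set d := gap x W; rewrite !quadM.
have vM f g : v * (f * g) = f * (v * g) + del f * g.
  by rewrite /lbr mulrBl !mulrA addrC subrK.
rewrite (vM d) mulrDr (vM d) (vM (del d)) mulrDr -scalerAr scaler_nat mulr2n.
by rewrite [RHS]addrAC -!addrA.
Qed.

Lemma sum_tuple_cons n (F : n.+1.-tuple bool -> D) :
  \sum_W F W = \sum_(W : n.-tuple bool) \sum_x F (cons_tuple x W).
Proof.
rewrite pair_bigA /= (reindex (fun p : n.-tuple bool * bool => cons_tuple p.2 p.1)) //=.
exists (fun W : n.+1.-tuple bool => (behead_tuple W, thead W)) => [[W x] _|W _] /=.
  by congr pair; apply: val_inj.
by apply: val_inj; rewrite /= [in RHS](tuple_eta W).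
Qed.

Lemma span_level0 f : span 0 f -> inO f.
Proof. by case. Qed.

Lemma evec_eigen_mod n (i : bool * n.-tuple bool) :
  span n ((v - (sg i.1)%:A) * evec i.1 i.2).
Proof. by rewrite evec_eigen -{1}(size_tuple i.2); apply: span_quad_wvec. Qed.

(** By [eig_indep] it suffices to treat constant coefficients at a single eigenvalue. At level 0
    they multiply a pole, which is not in [inO]; at level n + 1, applying v - [sg t] turns the
    relation into one at level n. *)
Lemma level_indep n (g : bool * n.-tuple bool -> D) : (forall i, inK (g i)) ->
  span n (\sum_i g i * evec i.1 i.2) -> forall i, g i = 0.
Proof.
elim: n g => [|n IH]; apply: (@eig_indep _ _ _ (fun i => i.1) (@evec_eigen_mod _)).
  move=> t al al0; rewrite (bigD1 (t, [tuple])) //= big1 => [|[t' W] /= ne]; last first.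
    by rewrite al0 ?scale0r //=; apply: contraNneq ne => ->; rewrite (tuple0 W).
  rewrite addr0 => /span_level0.
  have -> : evec t [tuple] = pole (sg t) 0.
    apply: (mulIr quad_unit); rewrite divrK ?quad_unit //= (quadE t).
    by rewrite mulKr ?v_alg_unit.
  move=> Oal [t' W]; rewrite tuple0; have [->|ne] := eqVneq t' t; last by rewrite al0.
  by apply/eqP/negPn/negP => ne0; apply: (pole_notin_O ne0) Oal.
move=> t al al0 Sal.
(* Each eigenvector becomes [quad * wvec], and the words are regrouped by their tail, since removing
   the first letter is what lowers the level. *)
have E1 : (v - (sg t)%:A) * (\sum_i al i *: evec i.1 i.2) =
    \sum_(W : n.-tuple bool) \sum_x al (t, cons_tuple x W) *: (quad * wvec (x :: W)).
  rewrite -(sum_tuple_cons (fun W => al (t, W) *: (quad * wvec W))).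
  transitivity ((v - (sg t)%:A) * (\sum_t' \sum_(W : n.+1.-tuple bool) al (t', W) *: evec t' W)).
    by congr (_ * _); rewrite pair_bigA; apply: eq_bigr => -[].
  rewrite (bigD1 t) //=.
  rewrite [X in _ * (_ + X)]big1 => [|t' ne]; last first.
    by rewrite big1 // => W _; rewrite al0 ?scale0r.
  by rewrite addr0 mulr_sumr; apply: eq_bigr => W _; rewrite -scalerAr evec_eigen.
have [h Kh Sh] := span_top Sal.
(* The length-n coefficients, modulo [span n], of v - [sg t] applied to the relation minus its
   length-n part; by induction they vanish. *)
pose h2 (i : bool * n.-tuple bool) : D :=
  \sum_x al (t, cons_tuple x i.2) *: coef i.1 x i.2 - (del (h i) + (sg i.1 - sg t) *: h i).
have Kh2 i : inK (h2 i).
  apply: inKD; first by apply: inK_sum => x; apply/inKZ/inK_coef.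
  rewrite -scaleN1r; apply/inKZ/inKD; first exact: inK_lbr.
  exact: inKZ.
have h20 : forall i, h2 i = 0.
  apply: IH => //.
  have SP : span n ((v - (sg t)%:A) * (\sum_i al i *: evec i.1 i.2) -
      \sum_i (\sum_x al (t, cons_tuple x i.2) *: coef i.1 x i.2) * evec i.1 i.2).
    rewrite E1 -(pair_bigA _ (fun t' (W : n.-tuple bool) =>
      (\sum_x al (t, cons_tuple x W) *: coef t' x W) * evec t' W)) /=.
    rewrite [X in _ - X]exchange_big -sumrB; apply: span_sum => W _ /=.
    under [X in _ - X]eq_bigr do rewrite mulr_suml.
    rewrite [X in _ - X]exchange_big -sumrB; apply: span_sum => x _ /=.
    under [X in _ - X]eq_bigr do rewrite -scalerAl.
    rewrite -scaler_sumr -scalerBr; apply: spanZ.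
    by rewrite -[in span _](size_tuple W); apply: quad_wvec_mod.
  have SQ := v_sum_span t Kh (@evec_eigen_mod n).
  have := spanB (spanB (span_v_sg t Sh) SP) (spanZ (- 1) SQ).
  rewrite mulrBr scaleN1r opprK opprB [_ + (_ - _ * _)]addrC !subrKA -sumrB.
  by under eq_bigr do rewrite -mulrBl.
move=> [t' W']; have [->|ne] := eqVneq t' t; last by rewrite al0.
case/tupleP: W' => x W; have := h20 (t, W).
rewrite /h2 /= subrr scale0r addr0 => /eqP; rewrite subr_eq0 => /eqP eqh.
pose c := (2%:R * sg t)^-1.
(* [coef] is c b [gap] plus the derivative of a [gap] + c a [del gap]. Subtracting these primitives
   from h leaves an element whose derivative is a k-combination of gaps, as [cpow_no_log]
   requires. *)
pose h3 := h (t, W) - \sum_x al (t, cons_tuple x W) *: (a *: gap x W + (c * a) *: del (gap x W)).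
have Kh3 : inK h3.
  apply: inKD => //; rewrite -scaleN1r; apply/inKZ/inK_sum => y; apply/inKZ/inKD.
    exact/inKZ/inK_gap.
  exact/inKZ/inK_lbr/inK_gap.
have c0 : c != 0 by rewrite invr_eq0 mulf_neq0 ?two0 ?sg0.
have := @cpow_no_log (head true W) (fun x => al (t, cons_tuple x W) * (c * b)) h3 Kh3 _ x.
move=> /(_ _)/eqP; rewrite mulf_eq0 (negPf (mulf_neq0 c0 b0)) orbF => al1.
apply/eqP/al1; rewrite /h3 (lbrD (h (t, W))) -eqh -scaleN1r lbrZ lbr_sum scaleN1r -sumrB.
apply: eq_bigr => y _; rewrite lbrZ -scalerBr -[RHS]scalerA; congr (_ *: _).
rewrite lbrD !lbrZ /coef -/c [c *: (_ + _)]scalerDr !scalerA.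
by rewrite opprD addrACA subrr add0r addrAC subrr add0r.
Qed.

(** Coefficients are killed by descending word length: right multiplication by [cay / quad] turns
    the word W into a k(w)-multiple of [wvec W], and [level_indep] applies to the longest words
    left. *)
Theorem symST_free : free_on2 symS symT.
Proof.
move=> p up e.
suff main n : (forall q : k * seq bool, q \in p -> (n <= size q.2)%N -> q.1 = 0) ->
    forall q : k * seq bool, q \in p -> q.1 = 0.
  apply/allP => q qp; apply/eqP.
  (* Beyond the maximal length no word occurs, so the descent starts from a vacuous assumption. *)
  apply: (main (\max_(r <- p) size r.2).+1) qp => r rp.
  by rewrite ltnNge (@leq_bigmax_seq _ _ xpredT (fun r : k * seq bool => size r.2) _ rp).
elim: n => [|n IH] p0; first by move=> q qp; apply: p0.
apply: IH => q qp; rewrite leq_eqVlt => /orP[/eqP sq|]; last exact: p0.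
pose F (r : k * seq bool) : D := r.1 *: (cpow (head true r.2) * wvec r.2).
have sumF : \sum_(r <- p) F r = 0.
  transitivity (peval symS symT p * (cay / quad)); last by rewrite e mul0r.
  by rewrite mulr_suml; apply: eq_bigr => r _; rewrite -scalerAl weval_wvec.
have SF : span n (\sum_(r <- p | size r.2 == n) F r).
  move: sumF; rewrite (bigID (fun r => size r.2 == n)) /= => /eqP.
  rewrite addr_eq0 => /eqP ->; rewrite -scaleN1r; apply: spanZ.
  rewrite big_seq_cond; apply: span_sum => r /andP[rp rn].
  case: (ltngtP (size r.2) n) rn => // [lt|gt] _.
    by apply/spanZ/spanK/span_wvec; first exact: inK_cpow.
  by rewrite /F p0 // scale0r; apply: span0.
(* The factor (2 [sg])^-1 comes from [wvec_evec]; as the words of p are distinct, each sum has at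
   most one term. *)
pose g (i : bool * n.-tuple bool) : D :=
  \sum_(r <- p | r.2 == i.2) r.1 *: ((2%:R * sg i.1)^-1 *: cpow (head true i.2)).
have Kg i : inK (g i).
  by apply: inK_sum => r; do 2!apply: inKZ; apply: inK_cpow.
have Sg : span n (\sum_i g i * evec i.1 i.2).
  suff -> : \sum_i g i * evec i.1 i.2 = \sum_(r <- p | size r.2 == n) F r by [].
  transitivity (\sum_(t : bool) \sum_(W : n.-tuple bool) g (t, W) * evec t W).
    by rewrite pair_bigA; apply: eq_bigr => -[].
  rewrite exchange_big /=.
  transitivity (\sum_(W : n.-tuple bool) \sum_(r <- p | r.2 == W) F r).
    apply: eq_bigr => W _; under eq_bigr do rewrite /g mulr_suml.
    rewrite exchange_big; apply: eq_bigr => r rW0; have {rW0}rW : r.2 = W by apply/eqP.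
    rewrite /F rW wvec_evec mulr_sumr scaler_sumr; apply: eq_bigr => t _ /=.
    by rewrite -!scalerAl -scalerAr.
  rewrite (exchange_big_dep (fun r => size r.2 == n)) /=; last first.
    by move=> W r _ /eqP ->; rewrite size_tuple.
  apply: eq_bigr => r sr; rewrite (big_pred1 (Tuple sr)) //.
have sq' : size q.2 == n by rewrite sq.
have := level_indep Kg Sg (true, Tuple sq'); rewrite /g /=.
case/splitPr: qp up => p1 p2; rewrite map_cat /= cat_uniq /= => /and3P[_ n1 /andP[n2 _]].
rewrite negb_or in n1; case/andP: n1 => n1 _.
have z (p' : seq (k * seq bool)) c : q.2 \notin map snd p' ->
    \sum_(r <- p' | r.2 == q.2) r.1 *: c = 0 :> D.
  move=> np; rewrite big_seq_cond big_pred0 // => r; apply/negP => /andP[rp /eqP rq].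
  by move: np; rewrite -rq map_f.
rewrite big_cat big_cons /= eqxx !z // add0r addr0 scalerA -mulr_algl => e0.
have := mulIr (cpow_unit (head true q.2)); move/(_ _ _ (etrans e0 (esym (mul0r _))))/eqP.
rewrite scaler_eq0 oner_eq0 orbF mulf_eq0 invr_eq0 mulf_eq0 (negPf two0) (negPf s0) !orbF.
by move/eqP.
Qed.
End FreePair.

(** * The principal involution *)

Section Star.
Variables (k : fieldType) (D : unitAlgType k) (x y : D) (star : D -> D).
Hypothesis divD : division_ring D.
Hypothesis star_inv : principal_involution x y star.

Lemma starD u v : star (u + v) = star u + star v.
Proof. by have [/(_ 1 u v)] := star_inv; rewrite !scale1r. Qed.

Lemma star0 : star 0 = 0.
Proof. by apply: (addIr (star 0)); rewrite -starD !add0r. Qed.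

Lemma starZ (c : k) u : star (c *: u) = c *: star u.
Proof. by have [/(_ c u 0)] := star_inv; rewrite star0 !addr0. Qed.

Lemma starN u : star (- u) = - star u.
Proof. by rewrite -scaleN1r starZ scaleN1r. Qed.

Lemma starM u v : star (u * v) = star v * star u.
Proof. by have [_ ->] := star_inv. Qed.

Lemma starV u : u \is a GRing.unit -> star u^-1 = (star u)^-1.
Proof.
move=> uu; have [_ _ star1 _ _] := star_inv.
have e : star u * star u^-1 = 1 by rewrite -starM mulVr.
have su : star u \is a GRing.unit.
  apply: divD; apply: contra_eqN e => /eqP->.
  by rewrite mul0r eq_sym oner_eq0.
by apply: (mulrI su); rewrite e divrr.
Qed.

Lemma star_x : star x = - x. Proof. by have [_ _ _ _ []] := star_inv. Qed.
Lemma star_y : star y = - y. Proof. by have [_ _ _ _ []] := star_inv. Qed.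

Lemma star_hz : star (hz x y) = - hz x y.
Proof.
by rewrite /hz /lbr starD starN !starM star_x star_y !mulrNN opprB.
Qed.

Lemma star_hz3 : star (hz x y ^+ 3) = - hz x y ^+ 3.
Proof. by rewrite !exprS expr0 mulr1 !starM star_hz !mulrN !mulNr !opprK mulrA. Qed.

Lemma star_hV : star (hV x y) = hV x y.
Proof.
rewrite /hV starZ !starM (starD (x * y)) !starM star_x star_y star_hz !mulrNN.
by rewrite !(mulrN, mulNr, opprK) mulrA [y * x + _]addrC.
Qed.

Lemma star_hP : star (hP x y) = hQ x y.
Proof. by rewrite /hP starD star_hV starN starZ star_hz3 scalerN opprK. Qed.

Lemma star_hQ : star (hQ x y) = hP x y.
Proof. by rewrite /hQ starD star_hV starZ star_hz3 scalerN. Qed.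

Hypothesis uP : hP x y \is a GRing.unit.
Hypothesis uQ : hQ x y \is a GRing.unit.

(** The involution exchanges [hP] and [hQ] and reverses products, so it swaps the two summands of
    S. *)
Lemma star_hS : star (hS x y) = hS x y.
Proof. by rewrite /hS starD !starM !starV // star_hP star_hQ addrC. Qed.

Hypothesis uA : hz x y + y ^+ 2 \is a GRing.unit.
Hypothesis uB : hz x y - y ^+ 2 \is a GRing.unit.

(** The involution sends z + y^2 to -(z - y^2) and conversely. Reversing the product restores T, and
    the four signs cancel. *)
Lemma star_hT : star (hT x y) = hT x y.
Proof.
have sy : star (y ^+ 2) = y ^+ 2 by rewrite expr2 starM star_y mulrNN.
have sA : star (hz x y + y ^+ 2) = - (hz x y - y ^+ 2).
  by rewrite starD star_hz sy [RHS]opprB addrC.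
have sB : star (hz x y - y ^+ 2) = - (hz x y + y ^+ 2).
  by rewrite starD starN star_hz sy [RHS]opprD.
rewrite /hT !starM !starV // star_hS sA sB.
by rewrite !(mulNr, mulrN, invrN, opprK) !mulrA.
Qed.
End Star.

(** * The Heisenberg division ring *)

Section Heisenberg.
Variables (k : fieldType) (D : unitAlgType k) (x y : D).
Hypothesis char0 : [pchar k] =i pred0.
Hypothesis divD : division_ring D.
Hypothesis xyH : heis_rel x y.
Hypothesis xyU : UH_embeds x y.

(** If z vanished, the embedding of U(H) would make the bracket vanish in every representation;
    strictly upper triangular 3 by 3 matrices refute this. *)
Lemma hz_neq0 : hz x y != 0.
Proof.
apply/eqP => z0.
pose p : seq (k * seq bool) := [:: (1, [:: true; false]); (- 1, [:: false; true])].
have pE (A : algType k) (u v : A) : peval u v p = lbr v u.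
  by rewrite /peval !big_cons big_nil /= scale1r scaleN1r addr0 !mulr1.
have := @xyU p _ 'M[k]_3 (delta_mx 1 2%:R) (delta_mx 0 1).
have e12 : delta_mx (0 : 'I_3) (1 : 'I_3) * delta_mx (1 : 'I_3) (2%:R : 'I_3) =
    delta_mx 0 2%:R :> 'M[k]_3.
  exact: mul_delta_mx.
have d0 (i j l m : 'I_3) : j != l -> delta_mx i j * delta_mx l m = 0 :> 'M[k]_3.
  exact: mul_delta_mx_0.
rewrite !pE => /(_ z0) H.
have : lbr (delta_mx 0 1) (delta_mx 1 2%:R) = 0 :> 'M[k]_3.
  by apply: H; split; rewrite /lbr e12 ?d0 ?subr0 ?subrr // !d0 ?subrr.
rewrite /lbr e12 d0 // subr0 => /matrixP/(_ 0 2%:R)/eqP.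
by rewrite !mxE !eqxx oner_eq0.
Qed.

Local Notation z := (hz x y).
Let uz : z \is a GRing.unit. Proof. exact/divD/hz_neq0. Qed.

Lemma hz_comm_x : GRing.comm z x.
Proof. by apply/eqP; rewrite -subr_eq0; case: xyH => /eqP. Qed.

Lemma hz_comm_y : GRing.comm z y.
Proof. by apply/eqP; rewrite -subr_eq0; case: xyH => _ /eqP. Qed.

Definition hv : D := x * y / z + (2%:R : k)^-1%:A.
Definition hw : D := y ^+ 2 / z.

Lemma hw_neq0 : hw != 0.
Proof.
have y0 : y != 0.
  by apply: contraNneq hz_neq0 => y0; rewrite /hz /lbr y0 mul0r mulr0 subrr.
have uw : hw \is a GRing.unit by rewrite unitrMl ?unitrV // unitrX // divD.
by apply: contraTneq uw => ->; rewrite unitr0.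
Qed.

Lemma yx : y * x = x * y + z.
Proof. by rewrite addrC subrK. Qed.

(** As z is central, [v, w] = [xy, y^2] / z^2, and [xy, y^2] = [x, y^2] y = -2 z y^2. *)
Lemma lbr_hv_hw : lbr hv hw = - 2%:R *: hw.
Proof.
have zxy : GRing.comm z (x * y) := commrM hz_comm_x hz_comm_y.
have zy2 : GRing.comm z (y ^+ 2) := commrX 2 hz_comm_y.
have -> : lbr hv hw = lbr (x * y) (y ^+ 2) / z / z.
  rewrite /lbr /hv /hw mulrDl mulrDr mulr_algl mulr_algr opprD addrACA subrr addr0.
  have swap f g : GRing.comm z g -> f / z * (g / z) = f * g / z / z.
    by move=> /commr_sym/commrV zg; rewrite !mulrA -(mulrA f) -zg !mulrA.
  by rewrite !swap // -!mulrBl.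
have y2x : y ^+ 2 * x = x * y ^+ 2 + 2%:R *: (z * y).
  rewrite expr2 -mulrA yx mulrDr mulrA yx mulrDl -[y * z]hz_comm_y.
  by rewrite -addrA -mulr2n scaler_nat mulrA.
have -> : lbr (x * y) (y ^+ 2) = - 2%:R *: (y ^+ 2 * z).
  rewrite /lbr [y ^+ 2 * (x * y)]mulrA y2x mulrDl -(mulrA x y) -(mulrA x _ y) -exprS -exprSr.
  by rewrite opprD addrA subrr add0r scaleNr -scalerAl -mulrA -expr2 zy2.
by rewrite -!scalerAl mulrK.
Qed.

(** Half of xy + yx = 2xy + z is xy + z/2, which accounts for the summand 1/2 in [hv]; the powers of
    z are collected by centrality. *)
Lemma hV_hv : hV x y = z ^+ 3 * hv.
Proof.
have zxy : GRing.comm z (x * y) := commrM hz_comm_x hz_comm_y.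
have two0 : 2%:R != 0 :> k by rewrite natrk_eq0.
have xyE : x * y + y * x = 2%:R *: (x * y) + z by rewrite yx addrA scaler_nat.
rewrite /hV xyE [z * _]mulrDr mulrDl scalerDr [RHS]mulrDr mulr_algr.
have z3 : z ^+ 3 = z * z * z by rewrite !exprS expr0 mulr1 mulrA.
have zV : z^-1 * (x * y) = x * y / z by rewrite (commrV (commr_sym zxy)).
rewrite z3.
rewrite -scalerAr -scalerAl scalerA mulVf // scale1r; congr (_ + _).
rewrite -zV [RHS]mulrA mulrK // -[LHS]mulrA -[RHS]mulrA zxy.
reflexivity.
Qed.

Definition t3 : k := 3%:R^-1.

(** Equality would give 3i = 3j + 1 in k, hence in the naturals by characteristic zero, against
    reduction modulo 3. *)
Lemma t3_nonint i j : t3 != i%:R - j%:R.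
Proof.
have three0 : 3%:R != 0 :> k by rewrite natrk_eq0.
apply/eqP => /(congr1 ( *%R 3%:R)); rewrite mulfV // mulrBr -!natrM => /eqP.
rewrite eq_sym subr_eq -(natrD _ 1) eqrk_nat // => /eqP/(congr1 (modn^~ 3%N)).
by rewrite -modnDmr !modnMr.
Qed.

Lemma hz_comm_hv : GRing.comm z hv.
Proof.
have zxy : GRing.comm z (x * y) := commrM hz_comm_x hz_comm_y.
apply: commrD; last by rewrite /GRing.comm mulr_algl mulr_algr.
exact/commrM/commrV.
Qed.

Lemma hP_hv : hP x y = z ^+ 3 * (hv - t3%:A).
Proof. by rewrite /hP hV_hv [RHS]mulrBr mulr_algr. Qed.

Lemma hQ_hv : hQ x y = z ^+ 3 * (hv + t3%:A).
Proof. by rewrite /hQ hV_hv [RHS]mulrDr mulr_algr. Qed.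

Let uz3 : z ^+ 3 \is a GRing.unit. Proof. exact: unitrX. Qed.
Let hv_unit c : hv - c%:A \is a GRing.unit.
Proof. exact: (v_alg_unit char0 divD hw_neq0 lbr_hv_hw). Qed.
Let hv_unit' : hv + t3%:A \is a GRing.unit.
Proof. by rewrite -[_%:A]opprK -scaleNr. Qed.

Lemma hP_unit : hP x y \is a GRing.unit.
Proof. by rewrite hP_hv unitrMl. Qed.

Lemma hQ_unit : hQ x y \is a GRing.unit.
Proof. by rewrite hQ_hv unitrMl. Qed.

Lemma hz_hw : (z + y ^+ 2 = (1 + hw) * z) * (z - y ^+ 2 = (1 - hw) * z).
Proof. by rewrite mulrDl mulrBl mul1r /hw divrK. Qed.

Let uDw := oneDw_unit char0 divD hw_neq0 lbr_hv_hw.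
Let uBw := oneBw_unit char0 divD hw_neq0 lbr_hv_hw.

Lemma hzDy_unit : z + y ^+ 2 \is a GRing.unit.
Proof. by rewrite hz_hw unitrMl. Qed.

Lemma hzBy_unit : z - y ^+ 2 \is a GRing.unit.
Proof. by rewrite hz_hw unitrMl. Qed.

(** * The elements S and T in terms of v and w *)

Lemma sum_sqr_pm (u c : D) : (u - c) ^+ 2 + (u + c) ^+ 2 = 2%:R *: (u ^+ 2 + c ^+ 2).
Proof.
have -> : (u - c) ^+ 2 = u ^+ 2 + c ^+ 2 - (u * c + c * u).
  by rewrite !expr2 mulrBl !mulrBr opprB addrACA -opprD.
have -> : (u + c) ^+ 2 = u ^+ 2 + c ^+ 2 + (u * c + c * u).
  by rewrite !expr2 mulrDl !mulrDr [c * u + _]addrC addrACA.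
by rewrite addrACA addNr addr0 -mulr2n -scaler_nat.
Qed.

(** The factors z^3 cancel. With t = 1/3, S = ((v - t)^2 + (v + t)^2) / (v^2 - t^2) = 2 + 4 t^2 /
    (v^2 - t^2). *)
Lemma hS_symS : hS x y = symS hv t3 2%:R (4%:R * t3 ^+ 2).
Proof.
have q1 := quadE hv t3 true; have q2 := quadE hv t3 false.
rewrite /= scaleNr opprK in q1 q2.
have uq := quad_unit char0 divD hw_neq0 lbr_hv_hw t3.
have zA : GRing.comm (z ^+ 3) t3%:A by rewrite /GRing.comm mulr_algl mulr_algr.
have zv : GRing.comm (z ^+ 3) hv := commr_sym (commrX 3 (commr_sym hz_comm_hv)).
have zP : z ^+ 3 * (hv - t3%:A) = (hv - t3%:A) * z ^+ 3 := commrB zv zA.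
have zQ : z ^+ 3 * (hv + t3%:A) = (hv + t3%:A) * z ^+ 3 := commrD zv zA.
have -> : hS x y = (hv - t3%:A) / (hv + t3%:A) + (hv - t3%:A)^-1 * (hv + t3%:A).
  rewrite /hS hP_hv hQ_hv; congr (_ + _).
    by rewrite zP zQ invrM // mulrA mulrK.
  by rewrite invrM // -mulrA mulKr.
apply: (mulIr uq); rewrite /symS [RHS]mulrDl -[(_ *: _^-1) * _]scalerAl mulVr // mulr_algl.
rewrite mulrDl [X in X + _ = _](_ : _ = (hv - t3%:A) ^+ 2); last first.
  by rewrite q2 mulrA divrK.
rewrite [X in _ + X = _](_ : _ = (hv + t3%:A) ^+ 2); last first.
  by rewrite q1 mulrA -[_^-1 * _ * _]mulrA -q2 q1 mulKr.
set A := t3%:A; rewrite sum_sqr_pm /quad.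
have -> : A ^+ 2 = (t3 ^+ 2)%:A by rewrite expr2 mulr_algl scalerA -expr2.
rewrite scalerBr scalerDr !scalerA -addrA; congr (_ + _).
by rewrite -scaleNr -scalerDl; congr (_ *: _); ring.
Qed.

(** Writing z + y^2 = (1 + w) z and z - y^2 = (1 - w) z, with z commuting with w, makes the factors
    around S equal to c and its inverse. *)
Lemma hT_symT : hT x y = symT hv hw t3 2%:R (4%:R * t3 ^+ 2).
Proof.
have zw : GRing.comm z hw.
  by apply: commrM; [apply/commrX/hz_comm_y | apply/commrV].
have BD : GRing.comm (1 + hw) (1 - hw).
  by apply: commrB; [apply: commr1 | apply/commr_sym/commrD; first exact: commr1].
have zc : GRing.comm z (cay hw).
  apply: commrM; first by apply: commrB => //; apply: commr1.
  by apply/commrV/commrD => //; apply: commr1.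
have e1 : (z + y ^+ 2)^-1 * (z - y ^+ 2) = cay hw.
  apply: (mulrI hzDy_unit); rewrite mulVKr ?hzDy_unit // !hz_hw -mulrA zc !mulrA.
  by rewrite BD mulrK.
have e2 : (z + y ^+ 2) / (z - y ^+ 2) = (cay hw)^-1.
  by rewrite !hz_hw /cay !invrM ?unitrV // invrK mulrA mulrK.
by rewrite /hT e1 -[_ * _ / _]mulrA e2 hS_symS.
Qed.

Lemma hS_hT_free : free_on2 (hS x y) (hT x y).
Proof.
rewrite hS_symS hT_symT; apply: (symST_free char0 divD hw_neq0 lbr_hv_hw).
  exact: t3_nonint.
by rewrite mulf_neq0 ?natrk_eq0 // expf_neq0 // invr_neq0 // natrk_eq0.
Qed.

End Heisenberg.

Theorem mainTheorem6 (k : fieldType) (D : unitAlgType k) (x y : D)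
    (star : D -> D) :
  [pchar k] =i pred0 ->
  division_ring D ->
  heis_rel x y ->
  UH_embeds x y ->
  right_fractions x y ->
  principal_involution x y star ->
  [/\ hP x y \is a GRing.unit, hQ x y \is a GRing.unit,
      hz x y + y ^+ 2 \is a GRing.unit & hz x y - y ^+ 2 \is a GRing.unit] /\
  free_on2 (hS x y) (hT x y) /\
  (star (hS x y) = hS x y /\ star (hT x y) = hT x y).
Proof.
move=> char0 divD xyH xyU _ stI.
have uP := hP_unit char0 divD xyH xyU; have uQ := hQ_unit char0 divD xyH xyU.
have uA := hzDy_unit char0 divD xyH xyU; have uB := hzBy_unit char0 divD xyH xyU.
split; first by split.
split; first exact: hS_hT_free.
by split; [apply: star_hS | apply: star_hT].
Qed.
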